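(* Let $R$ be a ring of type (A), and let $\mathrm{max.Den}_l(R)=\{S_1,\ldots,S_n\}$ (with $S_1,\dots,S_n$ distinct). 1. If $n=1$ then $S_{1,c}=S_1=R\setminus\mathcal{N}_R$. 2. If $n\geq 2$ then, for each $i=1,\ldots,n$, $S_{i,c}=S_i\cap\bigcap_{j\neq i}\mathfrak{a}_j\neq\emptyset$, where $\mathfrak{a}_j=\mathrm{ass}(S_j)$.
   Context: All rings are associative with $1\neq 0$; ideals are two-sided. For a ring $R$: $R^*$ is the group of units, $\mathcal{C}_R$ is the set of (left and right) regular elements, i.e. non-zero-divisors, $\mathrm{rad}(R)$ is the Jacobson radical, and $\mathcal{N}_R$ is the nil radical, i.e. the sum of all nil ideals of $R$. A ring $R$ is local if $R\setminus R^*$ is an ideal of $R$. A subset $S\subseteq R$ closed under multiplication with $1\in S$, $0\notin S$ is a left Ore set if $Sr\cap Rs\neq\emptyset$ for all $r\in R$, $s\in S$; then $\mathrm{ass}(S):=\{r\in R: sr=0\text{ for some }s\in S\}$ is an ideal. A left Ore set $S$ is a left denominator set if $rs=0$ with $r\in R$, $s\in S$ implies $tr=0$ for some $t\in S$. For a left denominator set $S$, $S^{-1}R=\{s^{-1}r: s\in S,r\in R\}$ is the left localization of $R$ at $S$. $\mathrm{max.Den}_l(R)$ is the (non-empty) set of maximal elements, with respect to inclusion, of the set of left denominator sets of $R$. $\mathfrak{l}_R:=\bigcap_{S\in \mathrm{max.Den}_l(R)}\mathrm{ass}(S)$. The core of a left Ore set $S$ of $R$ is $S_c:=\{s\in S: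 \ker(s\cdot)=\mathrm{ass}(S)\}$, where $s\cdot:R\to R$, $r\mapsto sr$; $S_{i,c}$ denotes the core of $S_i$. $Q_{l,cl}(R):=\mathcal{C}_R^{-1}R$ is the classical left quotient ring; it exists iff $\mathcal{C}_R$ is a left Ore set. $S_{l,0}(R)$ is the largest left denominator set with $\mathrm{ass}=0$ (it exists), and $Q_l(R):=S_{l,0}(R)^{-1}R$. An element of $R$ is left localizable if it belongs to some left denominator set of $R$. $R$ is weakly left localizable if every non-nilpotent element of $R$ is left localizable. For ideals $\mathfrak a,\mathfrak b$ of $R$, ''$\mathfrak a$ is a nil ideal modulo $\mathfrak b$'' means that $(\mathfrak a+\mathfrak b)/\mathfrak b$ is a nil ideal of $R/\mathfrak b$. A ring $R$ is of type (A) if it satisfies one of the following three conditions (which are equivalent to each other): (1) $R$ is weakly left localizable, $\mathfrak{l}_R=0$, $|\mathrm{max.Den}_l(R)|<\infty$, $S^{-1}R$ is weakly left localizable for every $S\in\mathrm{max.Den}_l(R)$, and for all distinct $S,T\in\mathrm{max.Den}_l(R)$, $\mathrm{ass}(S)$ is not a nil ideal modulo $\mathrm{ass}(T)$; (2) $Q_{l,cl}(R)$ exists and $Q_{l,cl}(R)\simeq\prod_{i=1}^nR_i$ ($n\ge1$) where the $R_i$ are local rings with $\mathrm{rad}(R_i)=\mathcal{N}_{R_i}$; (3) $Q_l(R)\simeq\prod_{i=1}^nR_i$ ($n\ge1$) where the $R_i$ are local rings with $\mathrm{rad}(R_i)=\mathcal{N}_{R_i}$. *)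

(* Defs.v *)
From HB Require Import structures.
From mathcomp Require Import all_boot all_order all_algebra.
From mathcomp Require Import boolp classical_sets cardinality.

Set Implicit Arguments.
Unset Strict Implicit.
Unset Printing Implicit Defensive.

Import GRing.Theory.
Local Open Scope classical_set_scope.
Local Open Scope ring_scope.

(* [nzRingType]: associative rings with 1 != 0, not necessarily commutative. *)

Section Ideals.
Variable R : nzRingType.

(* [unitRingType] is not assumed, so units are described by hand. *)
Definition is_unit (x : R) : Prop := exists y, x * y = 1 /\ y * x = 1.

Definition regular_elements : set R := [set x | GRing.lreg x /\ GRing.rreg x].

Definition nilpotent (x : R) : Prop := exists k : nat, x ^+ k = 0.

Definition is_left_ideal (I : set R) : Prop :=
  [/\ I 0, (forall x y, I x -> I y -> I (x + y)) & (forall a x, I x -> I (a * x))].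

Definition is_ideal (I : set R) : Prop :=
  is_left_ideal I /\ (forall a x, I x -> I (x * a)).

Definition is_maximal_left_ideal (I : set R) : Prop :=
  [/\ is_left_ideal I, I <> setT
    & forall J, is_left_ideal J -> I `<=` J -> J <> setT -> J = I].

Definition jacobson_radical : set R :=
  \bigcap_(I in [set I | is_maximal_left_ideal I]) I.

Definition is_nil_ideal (I : set R) : Prop :=
  is_ideal I /\ (forall x, I x -> nilpotent x).

(* The sum of a family of ideals is the set of finite sums of elements of
   members of the family. *)
Definition nil_radical : set R :=
  [set x | exists k (a : 'I_k -> R),
     (forall i, exists2 I, is_nil_ideal I & I (a i)) /\ x = \sum_i a i].

Definition is_local : Prop := is_ideal [set x | ~ is_unit x].

(* For ideals a and b: every element of (a + b) / b is nilpotent in R / b,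
   i.e. every element of a + b has a power lying in b. *)
Definition nil_modulo (a b : set R) : Prop :=
  forall x y, a x -> b y -> exists k : nat, b ((x + y) ^+ k).

End Ideals.

Arguments regular_elements : clear implicits.
Arguments jacobson_radical : clear implicits.
Arguments nil_radical : clear implicits.

Section Localization.
Variable R : nzRingType.

Definition is_left_Ore (S : set R) : Prop :=
  [/\ S 1, ~ S 0, (forall s t, S s -> S t -> S (s * t))
    & forall r s, S s -> exists t u, S t /\ t * r = u * s].

Definition ass (S : set R) : set R := [set r | exists2 s, S s & s * r = 0].

Definition is_left_denominator (S : set R) : Prop :=
  is_left_Ore S /\
  (forall r s, S s -> r * s = 0 -> exists2 t, S t & t * r = 0).

Definition max_Den : set (set R) :=
  [set S | is_left_denominator S /\
           forall T, is_left_denominator T -> S `<=` T -> T = S].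

Definition left_loc_radical : set R := \bigcap_(S in max_Den) ass S.

Definition core (S : set R) : set R :=
  [set s | S s /\ [set r | s * r = 0] = ass S].

Definition left_localizable (x : R) : Prop :=
  exists2 S, is_left_denominator S & S x.

Definition weakly_left_localizable : Prop :=
  forall x, ~ nilpotent x -> left_localizable x.

(* S_{l,0}(R) *)
Definition is_largest_regular_denominator (S : set R) : Prop :=
  [/\ is_left_denominator S, ass S = [set 0]
    & forall T, is_left_denominator T -> ass T = [set 0] -> T `<=` S].

(* (Q, phi) is the left localization S^{-1}R of R at S: elements of S become
   invertible, every element of Q is of the form phi(s)^{-1} phi(r), and the
   kernel of phi is ass(S). For a left denominator set S such a pair exists by
   Ore's theorem and is unique up to a unique R-isomorphism. *)
Definition is_left_localization (S : set R) (Q : nzRingType)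
    (phi : {rmorphism R -> Q}) : Prop :=
  [/\ (forall s, S s -> is_unit (phi s)),
      (forall q, exists s r v,
         [/\ S s, phi s * v = 1, v * phi s = 1 & q = v * phi r])
    & (forall r, phi r = 0 <-> ass S r)].

End Localization.

Arguments max_Den : clear implicits.
Arguments left_loc_radical : clear implicits.

(* Finite direct product of rings with componentwise operations; the library
   provides this only for constant families. *)
Definition ring_prod (I : finType) (R : I -> nzRingType) : Type :=
  {dffun forall i, R i}.

Section RingProd.
Variables (I : finType) (R : I -> nzRingType).

HB.instance Definition _ := Choice.on (ring_prod R).

Implicit Types f g h : ring_prod R.

Definition rp_zero : ring_prod R := finfun (fun i => 0 : R i).
Definition rp_one : ring_prod R := finfun (fun i => 1 : R i).
Definition rp_opp f : ring_prod R := finfun (fun i => - f i).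
Definition rp_add f g : ring_prod R := finfun (fun i => f i + g i).
Definition rp_mul f g : ring_prod R := finfun (fun i => f i * g i).

Fact rp_addA : associative rp_add.
Proof. by move=> f g h; apply/ffunP => i; rewrite !ffunE addrA. Qed.
Fact rp_addC : commutative rp_add.
Proof. by move=> f g; apply/ffunP => i; rewrite !ffunE addrC. Qed.
Fact rp_add0 : left_id rp_zero rp_add.
Proof. by move=> f; apply/ffunP => i; rewrite !ffunE add0r. Qed.
Fact rp_addN : left_inverse rp_zero rp_opp rp_add.
Proof. by move=> f; apply/ffunP => i; rewrite !ffunE addNr. Qed.

HB.instance Definition _ :=
  GRing.isZmodule.Build (ring_prod R) rp_addA rp_addC rp_add0 rp_addN.

Fact rp_mulA : associative rp_mul.
Proof. by move=> f g h; apply/ffunP => i; rewrite !ffunE mulrA. Qed.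
Fact rp_mul1l : left_id rp_one rp_mul.
Proof. by move=> f; apply/ffunP => i; rewrite !ffunE mul1r. Qed.
Fact rp_mul1r : right_id rp_one rp_mul.
Proof. by move=> f; apply/ffunP => i; rewrite !ffunE mulr1. Qed.
Fact rp_mulDl : left_distributive rp_mul +%R.
Proof. by move=> f g h; apply/ffunP => i; rewrite !ffunE mulrDl. Qed.
Fact rp_mulDr : right_distributive rp_mul +%R.
Proof. by move=> f g h; apply/ffunP => i; rewrite !ffunE mulrDr. Qed.

HB.instance Definition _ := GRing.Zmodule_isPzRing.Build (ring_prod R)
  rp_mulA rp_mul1l rp_mul1r rp_mulDl rp_mulDr.

End RingProd.

Definition ring_iso (A B : pzRingType) : Prop :=
  exists f : {rmorphism A -> B}, bijective f.

Definition iso_prod_local_nil (Q : nzRingType) : Prop :=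
  exists (n : nat) (K : 'I_n -> nzRingType),
    [/\ (0 < n)%N,
        (forall i, is_local (K i) /\ jacobson_radical (K i) = nil_radical (K i))
      & ring_iso Q (ring_prod K)].

Section TypeA.
Variable R : nzRingType.

Definition typeA1 : Prop :=
  [/\ weakly_left_localizable R,
      left_loc_radical R = [set 0],
      finite_set (max_Den R),
      (forall S, max_Den R S ->
         exists (Q : nzRingType) (phi : {rmorphism R -> Q}),
           is_left_localization S phi /\ weakly_left_localizable Q)
    & (forall S T, max_Den R S -> max_Den R T -> S <> T ->
         ~ nil_modulo (ass S) (ass T))].

Definition typeA2 : Prop :=
  is_left_Ore (regular_elements R) /\
  exists (Q : nzRingType) (phi : {rmorphism R -> Q}),
    is_left_localization (regular_elements R) phi /\ iso_prod_local_nil Q.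

Definition typeA3 : Prop :=
  exists S : set R, is_largest_regular_denominator S /\
  exists (Q : nzRingType) (phi : {rmorphism R -> Q}),
    is_left_localization S phi /\ iso_prod_local_nil Q.

Definition typeA : Prop := [\/ typeA1, typeA2 | typeA3].

End TypeA.

(* Main.v *)
(** In each of the three cases [R] embeds into a finite product of rings [K i]
    in which every element is nilpotent or a unit, in such a way that the
    maximal left denominator sets are the [S i = p i @^-1` units of K i] and
    that, for each [i], some [b i] in [R] is a unit in [K i] and vanishes in the
    other factors.  Then [ass (S i)] is the kernel of [p i], and multiplying by
    the [b i] computes the cores.

    Under (2) or (3) the factors are the given local rings.  Clearing
    denominators yields the [b i] and the Ore condition for the [S i]; every
    left denominator set [T] lies in some [S i], for otherwise a product of
    powers of elements of [T] would vanish in all factors.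

    Under (1) one takes [K i = (S i)^-1 R].  If [T] is a left denominator set of
    [K i], so is the monoid generated by [T] and the units; its preimage in [R]
    is a left denominator set containing [S i], hence equal to [S i], so [T]
    consists of units and weak localizability makes every non-nilpotent element
    of [K i] a unit. *)

Require Import Defs.
From HB Require Import structures.
From mathcomp Require Import all_boot all_order all_algebra.
From mathcomp Require Import boolp classical_sets cardinality.

Set Implicit Arguments.
Unset Strict Implicit.
Unset Printing Implicit Defensive.

Import GRing.Theory.
Local Open Scope classical_set_scope.
Local Open Scope ring_scope.

(** * Rings whose elements are nilpotent or units; nil ideals and local rings *)

Section NilpotentsAndUnits.
Variable K : nzRingType.
Implicit Types x y : K.

Lemma nilpotent_lmul_neq1 x y : nilpotent x -> y * x <> 1.
Proof.
move=> [k xk] yx; suff: (1 : K) = 0 by move/eqP; rewrite oner_eq0.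
elim: k xk => // k IH; rewrite exprS => /(congr1 ( *%R y)).
by rewrite mulrA yx mul1r mulr0.
Qed.

Lemma nilpotent_rmul_neq1 x y : nilpotent x -> x * y <> 1.
Proof.
move=> [k xk] xy; suff: (1 : K) = 0 by move/eqP; rewrite oner_eq0.
elim: k xk => // k IH; rewrite exprSr => /(congr1 ( *%R^~ y)).
by rewrite -mulrA xy mulr1 mul0r.
Qed.

Lemma nilpotent_not_unit x : nilpotent x -> ~ is_unit x.
Proof. by move=> xnil [y [xy _]]; apply: nilpotent_rmul_neq1 xy. Qed.

Lemma is_unit1 : is_unit (1 : K).
Proof. by exists 1; rewrite mulr1. Qed.

Lemma not_unit0 : ~ is_unit (0 : K).
Proof. by apply: nilpotent_not_unit; exists 1%N; rewrite expr1. Qed.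

Lemma is_unitM x y : is_unit x -> is_unit y -> is_unit (x * y).
Proof.
move=> [x' [xx' x'x]] [y' [yy' y'y]]; exists (y' * x'); split.
  by rewrite mulrA -(mulrA x) yy' mulr1.
by rewrite mulrA -(mulrA y') x'x mulr1.
Qed.

Lemma unit_mull_eq0 x y : is_unit x -> x * y = 0 -> y = 0.
Proof. by move=> [v [_ vx]] xy; rewrite -[y]mul1r -vx -mulrA xy mulr0. Qed.

Lemma unit_mulr_eq0 x y : is_unit y -> x * y = 0 -> x = 0.
Proof. by move=> [v [yv _]] xy; rewrite -[x]mulr1 -yv mulrA xy mul0r. Qed.

Definition nil_or_unit := forall x, nilpotent x \/ is_unit x.

(** A unit multiple of [x] would give [x] a one-sided inverse, impossible for a nilpotent. If [v]
    inverts [x + y], then [v * y = 1 - v * x] would be both nilpotent and, by the geometric series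
    in the nilpotent [v * x], invertible. *)
Lemma nil_or_unit_ideal : nil_or_unit -> is_ideal (@nilpotent K).
Proof.
move=> nuK.
have nilM a x : nilpotent x -> nilpotent (a * x).
  move=> xnil; have [//|[v [_ vax]]] := nuK (a * x).
  by have := @nilpotent_lmul_neq1 x (v * a) xnil; rewrite -mulrA.
split; last first.
  move=> a x xnil; have [//|[v [xav _]]] := nuK (x * a).
  by have := @nilpotent_rmul_neq1 x (a * v) xnil; rewrite mulrA.
split=> [|x y xnil ynil|//]; first by exists 1%N; rewrite expr1.
have [//|[v [_ vxy]]] := nuK (x + y).
have [k vxk] := nilM v x xnil.
have vynil := nilM v y ynil.
exfalso; apply: (@nilpotent_rmul_neq1 (v * y) (\sum_(i < k) (v * x) ^+ i) vynil).
have -> : v * y = - (v * x - 1) by rewrite -vxy mulrDr opprB addrC addKr.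
by rewrite mulNr -subrX1 vxk sub0r opprK.
Qed.

Lemma prod_eq0 (I : eqType) (r : seq I) (P : pred I) (F : I -> K) i :
  i \in r -> P i -> F i = 0 -> \prod_(j <- r | P j) F j = 0.
Proof.
move=> + Pi Fi; elim: r => // j r IH; rewrite inE big_cons.
case/predU1P => [<-|/IH ->]; first by rewrite Pi Fi mul0r.
by rewrite mulr0 if_same.
Qed.

Lemma zero_nil_ideal : is_nil_ideal [set (0 : K)].
Proof.
split; last by move=> x ->; exists 1%N; rewrite expr1.
split; last by move=> a x ->; rewrite mul0r.
by split=> // [x y -> ->|a x ->]; rewrite ?addr0 ?mulr0.
Qed.

(** Modulo [J], powers of [x + y] agree with powers of [x], so some power of [x + y] falls into [J],
    where it is nilpotent. *)
Lemma nil_idealD (I J : set K) : is_nil_ideal I -> is_nil_ideal J ->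
  is_nil_ideal [set z | exists x y, [/\ I x, J y & z = x + y]].
Proof.
move=> [[[I0 ID IM] IMr] Inil] [[[J0 JD JM] JMr] Jnil].
split; first split; first split.
- by exists 0, 0; rewrite addr0.
- move=> _ _ [x [y [Ix Jy ->]]] [x' [y' [Ix' Jy' ->]]].
  by exists (x + x'), (y + y'); rewrite addrACA; split; auto.
- by move=> a _ [x [y [Ix Jy ->]]]; exists (a * x), (a * y); rewrite mulrDr; split; auto.
- by move=> a _ [x [y [Ix Jy ->]]]; exists (x * a), (y * a); rewrite mulrDl; split; auto.
move=> _ [x [y [Ix Jy ->]]]; have [k xk] := Inil x Ix.
have [z Jz xyk] : exists2 z, J z & (x + y) ^+ k = x ^+ k + z.
  elim: k {xk} => [|k [z Jz xyk]]; first by exists 0; rewrite ?addr0.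
  exists (x * z + y * (x ^+ k + z)); last by rewrite !exprS xyk mulrDl mulrDr addrA.
  by apply: JD; [apply: JM | apply: JMr].
have [l zl] := Jnil z Jz.
by exists (k * l)%N; rewrite exprM xyk xk add0r.
Qed.

Lemma nil_radical_nilpotent x : nil_radical K x -> nilpotent x.
Proof.
move=> [k [a [nila ->]]].
suff [I [_ Inil] Ia] : exists2 I, is_nil_ideal I & I (\sum_i a i) by exact: Inil.
apply: (big_ind (fun z => exists2 I, is_nil_ideal I & I z)) => //.
- by exists [set 0] => //; exact: zero_nil_ideal.
- move=> y z [I nilI Iy] [J nilJ Jz].
  by exists [set u | exists x y, [/\ I x, J y & u = x + y]];
    [exact: nil_idealD | exists y, z].
Qed.

Lemma nil_ideal_sub_nil_radical (I : set K) : is_nil_ideal I -> I `<=` nil_radical K.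
Proof.
by move=> nilI x Ix; exists 1%N, (fun=> x); rewrite big_ord1; split=> // _; exists I.
Qed.

(** A proper left ideal consists of non-units, so a maximal one must equal the ideal of all
    non-units. *)
Lemma local_jacobson x : is_local K -> ~ is_unit x -> jacobson_radical K x.
Proof.
move=> [locK _] xNu I [[I0 ID IM] InT Imax].
suff <- : [set x : K | ~ is_unit x] = I by [].
apply: Imax => //; last first.
  by move/seteqP => [_ /(_ 1 Logic.I)]; apply; exact: is_unit1.
move=> y Iy [v [_ vy]]; apply: InT; apply/seteqP; split=> // z _.
by rewrite -[z]mulr1 -vy mulrA; apply: IM.
Qed.

Lemma local_nil_or_unit :
  is_local K -> jacobson_radical K = nil_radical K -> nil_or_unit.
Proof.
move=> locK radK x; have [xu|xNu] := pselect (is_unit x); [by right|left].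
by apply: nil_radical_nilpotent; rewrite -radK; apply: local_jacobson.
Qed.

End NilpotentsAndUnits.

Section Morphisms.
Variables (A B : nzRingType) (f : {rmorphism A -> B}).

Lemma rmorph_nilpotent x : nilpotent x -> nilpotent (f x).
Proof. by move=> [k xk]; exists k; rewrite -rmorphXn xk rmorph0. Qed.

Lemma ideal_preimage (I : set B) : is_ideal I -> is_ideal (f @^-1` I).
Proof.
move=> [[I0 ID IM] IMr]; rewrite /preimage.
split; last by move=> a x /= Ix; rewrite rmorphM; exact: IMr.
split=> [|x y /= Ix Iy|a x /= Ix]; rewrite /= ?rmorph0 ?rmorphD ?rmorphM //.
- exact: ID.
- exact: IM.
Qed.

End Morphisms.

(** * Left denominator sets and the monoids they generate *)

Section Denominators.
Variable R : nzRingType.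
Implicit Types (S T U : set R) (r s : R).

Lemma denominatorX S s k : is_left_denominator S -> S s -> S (s ^+ k).
Proof.
move=> [[S1 _ SM _] _] Ss; elim: k => [|k IH]; first by rewrite expr0.
by rewrite exprS; apply: SM.
Qed.

Lemma denominator_prod S (I : finType) (P : pred I) (F : I -> R) :
  is_left_denominator S -> (forall i, P i -> S (F i)) ->
  S (\prod_(i | P i) F i).
Proof. by move=> [[S1 _ SM _] _] SF; apply: big_ind. Qed.

Lemma assM S a r : is_left_denominator S -> ass S r -> ass S (a * r).
Proof.
move=> [[_ _ _ Sore] _] [s Ss sr]; have [t [u [St ta]]] := Sore a s Ss.
by exists t => //; rewrite mulrA ta -mulrA sr mulr0.
Qed.

Lemma units_denominator : is_left_denominator (@is_unit R).
Proof.
split; last by move=> r s su rs; exists 1; [exact: is_unit1|rewrite (unit_mulr_eq0 su rs) mulr0].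
split; [exact: is_unit1 | exact: not_unit0 | exact: is_unitM |].
move=> r s [v [_ vs]]; exists 1, (r * v); split; first exact: is_unit1.
by rewrite mul1r -mulrA vs mulr1.
Qed.

(** Words grow one letter at a time on the left, so the Ore and denominator conditions pass from
    letters to words by induction. *)
Inductive generated_monoid (A : set R) : R -> Prop :=
| generated_monoid1 : generated_monoid A 1
| generated_monoidM a w : A a -> generated_monoid A w -> generated_monoid A (a * w).

Lemma sub_generated_monoid (A : set R) : A `<=` generated_monoid A.
Proof.
by move=> a Aa; rewrite -[a]mulr1; apply: generated_monoidM => //; left.
Qed.

Lemma generated_monoid_denominator S T :
  is_left_denominator S -> is_left_denominator T ->
  ~ generated_monoid (S `|` T) 0 ->
  is_left_denominator (generated_monoid (S `|` T)).
Proof.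
move=> [[_ _ _ Sore] Sden] [[_ _ _ Tore] Tden] W0.
have ore r a : (S `|` T) a -> exists t u, (S `|` T) t /\ t * r = u * a.
  by case=> [/(Sore r)|/(Tore r)] [t [u [? ?]]]; exists t, u; split=> //; [left|right].
have den r a : (S `|` T) a -> r * a = 0 -> exists2 t, (S `|` T) t & t * r = 0.
  by move=> [/Sden|/Tden] /[apply] -[t ? ?]; exists t => //; [left|right].
split; first split=> //.
- by left.
- move=> s t Ws Wt; elim: Ws => [|a w Aa _ IH]; first by rewrite mul1r.
  by rewrite -mulrA; right.
- move=> r s Ws; elim: Ws r => [|a w Aa _ IH] r.
    by exists 1, r; split; [left | rewrite mul1r mulr1].
  have [t [u [Wt tr]]] := IH r; have [t' [u' [At' t'u]]] := ore u a Aa.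
  exists (t' * t), u'; split; first by right.
  by rewrite -mulrA tr !mulrA t'u.
- move=> r s Ws; elim: Ws r => [|a w Aa _ IH] r.
    by rewrite mulr1 => ->; exists 1; [left | rewrite mulr0].
  rewrite mulrA => /IH [t Wt]; rewrite mulrA => /(den _ _ Aa) [t' At' t'tr].
  by exists (t' * t); [right | rewrite -mulrA].
Qed.

(** Zero is not a word: if [a * w] lies in [ass T] for a letter [a] of either kind, so does [w];
    stripping all letters would put 1 in [ass T], hence 0 in [T]. *)
Lemma generated_monoid_units_denominator T : is_left_denominator T ->
  is_left_denominator (generated_monoid (T `|` @is_unit R)).
Proof.
move=> Tden; apply: generated_monoid_denominator => //; first exact: units_denominator.
suff Wass w : generated_monoid (T `|` @is_unit R) w -> ~ ass T w.
  by move/Wass; apply; exists 1; [have [[]] := Tden | rewrite mulr0].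
have [[_ T0 TM _] _] := Tden.
elim=> [|a {}w Aa _ IH]; first by move=> [s Ts]; rewrite mulr1 => s0; rewrite s0 in Ts.
case: Aa => [Ta [s Ts saw]|[v [_ va]] awT]; apply: IH.
  by exists (s * a); [exact: TM | rewrite -mulrA].
by rewrite -[w]mul1r -va -mulrA; apply: assM.
Qed.

End Denominators.

(** * Localization at a maximal left denominator set *)

Section LocalizationAtMaximal.
Variables (R Q : nzRingType) (S : set R) (phi : {rmorphism R -> Q}).
Hypothesis locS : is_left_localization S phi.

Lemma localization_numerator q : exists s c, S s /\ phi s * q = phi c.
Proof.
have [_ /(_ q) [s [c [v [Ss sv _ ->]]]] _] := locS.
by exists s, c; split=> //; rewrite mulrA sv mul1r.
Qed.

Lemma localization_numerator2 q q' : is_left_denominator S ->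
  exists s c c', [/\ S s, phi s * q = phi c & phi s * q' = phi c'].
Proof.
move=> [[_ _ SM Sore] _].
have [s [c [Ss sc]]] := localization_numerator q.
have [s' [c' [Ss' sc']]] := localization_numerator q'.
have [t [u [St ts]]] := Sore s s' Ss'.
exists (t * s), (t * c), (u * c'); split; first exact: SM.
  by rewrite !rmorphM -mulrA sc.
by rewrite ts !rmorphM -mulrA sc'.
Qed.

(** An equation over [Q] becomes, after clearing denominators, an equation in [R] up to an element
    of [ass S]; one more left factor from [S] removes that error. All these factors map into [W]. *)
Lemma preimage_denominator (W : set Q) :
  is_left_denominator S -> is_left_denominator W -> phi @` S `<=` W ->
  is_left_denominator (phi @^-1` W).
Proof.
move=> Sden [[W1 W0 WM Wore] Wden] SW.
have WS s : S s -> W (phi s) by move=> Ss; apply: SW; exists s.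
have [_ _ ker] := locS.
split; first split.
- by rewrite /preimage /= rmorph1.
- by rewrite /preimage /= rmorph0.
- by move=> s t; rewrite /preimage /= rmorphM; apply: WM.
- move=> r s /(Wore (phi r)) [w [v [Ww wr]]].
  have [x [c [d [Sx xw xv]]]] := localization_numerator2 w v Sden.
  have [y Sy yeq] : ass S (c * r - d * s).
    by apply/ker; rewrite rmorphB !rmorphM -xw -xv -!mulrA wr subrr.
  exists (y * c), (y * d); split.
    by rewrite /preimage /= rmorphM -xw; do 2?apply: (WM); auto.
  by apply/eqP; rewrite -!mulrA -subr_eq0 -mulrBr yeq.
- move=> r s /= Ws rs; have [|w Ww wr] := Wden (phi r) (phi s) Ws.
    by rewrite -rmorphM rs rmorph0.
  have [x [c [Sx xw]]] := localization_numerator w.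
  have [y Sy yeq] : ass S (c * r) by apply/ker; rewrite rmorphM -xw -mulrA wr mulr0.
  exists (y * c); last by rewrite -mulrA.
  by rewrite /preimage /= rmorphM -xw; do 2?apply: (WM); auto.
Qed.

Lemma max_localizable_is_unit (q : Q) : max_Den R S -> left_localizable q -> is_unit q.
Proof.
move=> [Sden Smax] [T Tden Tq]; set W := generated_monoid (T `|` @is_unit Q).
have [unitS _ _] := locS.
have Wden : is_left_denominator W := generated_monoid_units_denominator Tden.
have WT x : T x -> W x by move=> ?; apply: sub_generated_monoid; left.
have Wunit x : is_unit x -> W x by move=> ?; apply: sub_generated_monoid; right.
have pW : phi @^-1` W = S.
  apply: Smax; last by move=> s /unitS /Wunit.
  by apply: preimage_denominator => // _ [s /unitS /Wunit ? <-].
have [s [c [Ss sq]]] := localization_numerator q.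
(* The numerator of [q] maps into [W], so maximality places it in [S], and [q] becomes a quotient of
   two units. *)
have Sc : S c.
  rewrite -pW /preimage /= -sq; have [[_ _ WM _] _] := Wden.
  by apply: WM; [apply/Wunit/unitS | apply: WT].
have [x [sx xs]] := unitS s Ss; have -> : q = x * phi c by rewrite -sq mulrA xs mul1r.
by apply: is_unitM; [exists (phi s) | apply: unitS].
Qed.

Lemma max_localization_units : max_Den R S -> S = [set r | is_unit (phi r)].
Proof.
move=> [Sden Smax]; apply/esym; have [unitS _ _] := locS; apply: Smax => //.
apply: (@preimage_denominator (@is_unit Q)) => //; first exact: units_denominator.
by move=> _ [s /unitS ? <-].
Qed.

End LocalizationAtMaximal.

(** * Kernels, cores and the nil radical from a separating family of maps *)

Section Separation.
Variable R : nzRingType.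

Definition separates (I : finType) (K : I -> nzRingType)
    (p : forall i, {rmorphism R -> K i}) : Prop :=
  [/\ forall i, nil_or_unit (K i),
      forall r, (forall i, p i r = 0) -> r = 0
    & exists b : I -> R, (forall i, is_unit (p i (b i))) /\
        (forall i j, j != i -> p j (b i) = 0)].

Variables (I : finType) (K : I -> nzRingType) (p : forall i, {rmorphism R -> K i}).
Hypothesis psep : separates p.

(** If [p i r = 0], then [b i * r] vanishes in every factor, so [b i] is the annihilating
    denominator. *)
Lemma separates_ass i : ass [set r | is_unit (p i r)] = [set r | p i r = 0].
Proof.
have [_ inj [b [bu b0]]] := psep; apply/seteqP; split=> r /=.
  by move=> [s su sr]; apply: (unit_mull_eq0 su); rewrite -rmorphM sr rmorph0.
move=> r0; exists (b i) => //; first exact: bu.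
apply: inj => j; rewrite rmorphM; have [->|/b0 ->] := eqVneq j i.
  by rewrite r0 mulr0.
by rewrite mul0r.
Qed.

(** For [j != i], [b j] lies in the kernel of [p i], so a core element [s] satisfies [s * b j = 0];
    as [b j] is a unit in [K j], [s] vanishes there. Conversely, if [s] vanishes off [i], then
    [s * r] is decided by its component at [i] alone. *)
Lemma separates_core i :
  core [set r | is_unit (p i r)] =
  [set r | is_unit (p i r)] `&` [set r | forall j, j != i -> p j r = 0].
Proof.
have [_ inj [b [bu b0]]] := psep; apply/seteqP; split=> s /=.
  rewrite /core /= separates_ass => -[su /seteqP [_ kerS]]; split=> // j ji.
  apply: (unit_mulr_eq0 (bu j)).
  by rewrite -rmorphM (kerS (b j)) ?rmorph0 //= b0 // eq_sym.
move=> [su s0]; split=> //; rewrite separates_ass; apply/seteqP; split=> r /= sr.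
  by apply: (unit_mull_eq0 su); rewrite -rmorphM sr rmorph0.
apply: inj => j; rewrite rmorphM; have [->|/s0 ->] := eqVneq j i.
  by rewrite sr mulr0.
by rewrite mul0r.
Qed.

Lemma separates_core_neq0 i : core [set r | is_unit (p i r)] !=set0.
Proof.
have [_ _ [b [bu b0]]] := psep; exists (b i); rewrite separates_core.
by split; [exact: bu | exact: b0].
Qed.

(** With a single index [p i] is injective, so the preimage of the nilpotents of [K i] is itself a
    nil ideal. *)
Lemma separates_nil_radical i : (forall j, j = i) ->
  [set r | is_unit (p i r)] = ~` nil_radical R.
Proof.
move=> I1; have [nuK inj _] := psep; apply/seteqP; split=> r /=.
  by move=> ru /nil_radical_nilpotent /(rmorph_nilpotent (p i)) /nilpotent_not_unit.
move=> rN; have [rnil|//] := nuK i (p i r); exfalso; apply: rN.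
apply: (@nil_ideal_sub_nil_radical _ (p i @^-1` @nilpotent (K i))) => //.
split; first exact/ideal_preimage/nil_or_unit_ideal.
move=> x /= [k xk]; exists k; apply: inj => j.
by have := xk; rewrite -rmorphXn -(I1 j).
Qed.

End Separation.

(** * Maximal left denominator sets of a ring with a product as left quotient ring *)

Section Fractions.
Variables (R : nzRingType) (I : finType) (K : I -> nzRingType).
Variable p : forall i, {rmorphism R -> K i}.
Hypothesis nuK : forall i, nil_or_unit (K i).
Hypothesis p_inj : forall r, (forall i, p i r = 0) -> r = 0.
(* Together with injectivity: [\prod_i K i] is a left quotient ring of [R]. *)
Hypothesis p_frac : forall q : (forall i, K i),
  exists s c, forall i, is_unit (p i s) /\ p i s * q i = p i c.

Lemma fractions_separates : separates p.
Proof.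
split=> //.
have /choice [b bP] i : exists b, is_unit (p i b) /\ forall j, j != i -> p j b = 0.
  (* [b i] is a numerator of the idempotent that is 1 at [i] and 0 elsewhere. *)
  have [s [c sc]] := p_frac (dfwith (fun j => 0 : K j) (1 : K i)).
  exists c; split=> [|j ji]; [have [su <-] := sc i | have [_ <-] := sc j].
    by rewrite dfwith_in mulr1.
  by rewrite dfwith_out ?mulr0 // eq_sym.
by exists b; split=> i; have [] := bP i.
Qed.

Lemma fractions_denominator i : is_left_denominator [set r | is_unit (p i r)].
Proof.
have [_ _ [b [bu b0]]] := fractions_separates.
split; last first.
  move=> r s /= su rs.
  change (ass [set r | is_unit (p i r)] r); rewrite (separates_ass fractions_separates) /=.
  by apply: (unit_mulr_eq0 su); rewrite -rmorphM rs rmorph0.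
split; rewrite /= ?rmorph1 ?rmorph0; [exact: is_unit1 | exact: not_unit0 | |].
  by move=> s t /= ? ?; rewrite rmorphM; exact: is_unitM.
move=> r s /= [v [_ vs]].
(* The fraction is [b i * r / s] at [i] and 0 elsewhere. Its numerator [c] gives
   [x * b i * r = c * s] at [i], and both sides vanish in the other factors. *)
have [x [c xc]] := p_frac (dfwith (fun j => 0 : K j) (p i (b i) * p i r * v)).
exists (x * b i), c; split.
  by rewrite rmorphM; apply: is_unitM => //; have [] := xc i.
apply/eqP; rewrite -subr_eq0; apply/eqP/p_inj => j.
rewrite rmorphB !rmorphM; have [_ <-] := xc j.
have [->|ji] := eqVneq j i; first by rewrite dfwith_in -!mulrA vs mulr1 subrr.
by rewrite dfwith_out 1?eq_sym // b0 // !(mulr0, mul0r) subrr.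
Qed.

Lemma denominator_sub_fractions T : is_left_denominator T ->
  exists i, T `<=` [set r | is_unit (p i r)].
Proof.
move=> Tden; apply: contrapT => noi.
have /choice [t tP] i : exists t, T t /\ p i t = 0.
  have [t Tt tNu] : exists2 t, T t & ~ is_unit (p i t).
    apply: contrapT => not; apply: noi; exists i => r Tr /=.
    by apply: contrapT => ?; apply: not; exists r.
  have [[k tk]|//] := nuK (p i t).
  by exists (t ^+ k); rewrite rmorphXn tk; split=> //; apply: denominatorX.
have Tt : T (\prod_i t i) by apply: denominator_prod => // i _; have [] := tP i.
have [[_ T0 _ _] _] := Tden; apply: T0.
suff <- : \prod_i t i = 0 by [].
apply: p_inj => i; rewrite rmorph_prod.
by apply: (@prod_eq0 _ _ _ _ _ i); rewrite ?mem_index_enum //; have [] := tP i.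
Qed.

(** Every denominator set lies in one of these sets, and they are pairwise incomparable because
    [b i] is a unit in [K i] but zero in the other factors. *)
Lemma max_Den_fractions :
  max_Den R = [set [set r | is_unit (p i r)] | i in [set: I]].
Proof.
have [_ _ [b [bu b0]]] := fractions_separates.
apply/seteqP; split=> [T [Tden Tmax]|_ [i _ <-]].
  have [i Ti] := denominator_sub_fractions Tden.
  by exists i => //; apply: Tmax => //; exact: fractions_denominator.
split=> [|T Tden iT]; first exact: fractions_denominator.
have [j Tj] := denominator_sub_fractions Tden.
have [ji|/b0 pb] := eqVneq j i.
  by rewrite ji in Tj; apply/seteqP.
by have := Tj _ (iT _ (bu i)); rewrite /= pb => /not_unit0.
Qed.

End Fractions.

Definition separating_family (R : nzRingType) (I : finType) (S : I -> set R) :=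
  exists (K : I -> nzRingType) (p : forall i, {rmorphism R -> K i}),
    separates p /\ forall i, S i = [set r | is_unit (p i r)].

(** Transports a family indexed by local factors to an arbitrary enumeration of the same sets. The
    [b i] show that distinct indices of [S] give distinct sets, so the index map is onto;
    injectivity of [T] makes it one-to-one. *)
Lemma separating_family_reindex (R : nzRingType) (I J : finType)
    (S : I -> set R) (T : J -> set R) :
  separating_family S -> injective T ->
  [set S i | i in [set: I]] = [set T j | j in [set: J]] -> separating_family T.
Proof.
move=> [K [p [[nuK inj [b [bu b0]]] SE]]] T_inj ST.
have /choice [f fE] j : exists i, S i = T j.
  have : [set S i | i in [set: I]] (T j) by rewrite ST; exists j.
  by case=> i _ <-; exists i.
have f_surj i : exists j, f j = i.
  have : [set T j | j in [set: J]] (S i) by rewrite -ST; exists i.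
  case=> j _ TS; exists j; apply/eqP; apply: contraT => /b0 pb.
  have : S (f j) (b i) by rewrite fE TS SE; exact: bu.
  by rewrite SE /= pb => /not_unit0.
exists (fun j => K (f j)), (fun j => p (f j)); split; last by move=> j; rewrite -fE.
split=> [j|r r0|]; first exact: nuK.
  by apply: inj => i; have [j <-] := f_surj i.
exists (fun j => b (f j)); split=> [j|j k kj]; first exact: bu.
by apply: b0; apply: contraNneq kj => fkj; apply/eqP/T_inj; rewrite -!fE fkj.
Qed.

Section RingProdProjection.
Variables (I : finType) (K : I -> nzRingType) (i : I).

Definition rp_proj (f : ring_prod K) : K i := f i.

Fact rp_proj_zmod_morphism : zmod_morphism rp_proj.
Proof. by move=> f g; rewrite /rp_proj !ffunE. Qed.

Fact rp_proj_monoid_morphism : monoid_morphism rp_proj.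
Proof. by split=> [|f g]; rewrite /rp_proj !ffunE. Qed.

HB.instance Definition _ :=
  GRing.isZmodMorphism.Build (ring_prod K) (K i) rp_proj rp_proj_zmod_morphism.
HB.instance Definition _ :=
  GRing.isMonoidMorphism.Build (ring_prod K) (K i) rp_proj rp_proj_monoid_morphism.

End RingProdProjection.

(** * Separating families for rings of type (A), and the theorem *)

Section TypeA.
Variable R : nzRingType.

(** Serves (2) with the regular elements and (3) with the largest denominator set of zero [ass]. The
    maps are the coordinates of [R -> Q -> ring_prod K], and a tuple is a fraction because its
    preimage in [Q] is one. *)
Lemma product_localization_separating_family (S0 : set R) (Q : nzRingType)
    (phi : {rmorphism R -> Q}) :
  ass S0 = [set 0] -> is_left_localization S0 phi -> iso_prod_local_nil Q ->
  exists (m : nat) (T : 'I_m -> set R),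
    separating_family T /\ max_Den R = [set T i | i in [set: 'I_m]].
Proof.
move=> ass0 locS [m [K [_ locK [f [g fg gf]]]]].
pose p i : {rmorphism R -> K i} := @rp_proj _ K i \o (f \o phi).
have nuK i : nil_or_unit (K i) by have [? ?] := locK i; exact: local_nil_or_unit.
have inj r : (forall i, p i r = 0) -> r = 0.
  move=> r0; suff : ass S0 r by rewrite ass0.
  have [_ _ <-] := locS; apply: (can_inj fg); rewrite rmorph0.
  by apply/ffunP => i; rewrite ffunE; exact: r0.
have frac (q : forall i, K i) : exists s c, forall i, is_unit (p i s) /\ p i s * q i = p i c.
  pose q' : ring_prod K := finfun q.
  have [s [c [Ss sq]]] := localization_numerator locS (g q').
  have [unitS _ _] := locS; have [v [sv vs]] := unitS s Ss.
  exists s, c => i; split.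
    by exists (rp_proj i (f v)); rewrite /p /= -!rmorphM sv vs !rmorph1.
  have -> : q i = rp_proj i (f (g q')) by rewrite gf /rp_proj ffunE.
  by rewrite /p /= -!rmorphM sq.
exists m, (fun i => [set r | is_unit (p i r)]); split; last exact: max_Den_fractions.
by exists K, p; split=> //; exact: fractions_separates.
Qed.

Lemma ass_regular_elements : ass (regular_elements R) = [set 0].
Proof.
apply/seteqP; split=> [r [s [sreg _] sr]|r ->].
  by apply: sreg; rewrite sr mulr0.
by exists 1; [split; [exact: lreg1 | exact: rreg1] | rewrite mulr0].
Qed.

Lemma weakly_localizable_separating_family (n : nat) (S : 'I_n -> set R) :
  typeA1 R -> injective S -> max_Den R = [set S i | i in [set: 'I_n]] ->
  separating_family S.
Proof.
move=> [_ rad0 _ loc nnil] S_inj S_max.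
have Smax i : max_Den R (S i) by rewrite S_max; exists i.
have /choice [K pK] i := loc _ (Smax i).
pose p i := sval (cid (pK i)); have pP i := svalP (cid (pK i)).
have nuK i : nil_or_unit (K i).
  move=> x; have [xnil|xNnil] := pselect (nilpotent x); [by left|right].
  have [locS wll] := pP i.
  by apply: (max_localizable_is_unit locS) => //; exact: wll.
have SE i : S i = [set r | is_unit (p i r)].
  by have [locS _] := pP i; exact: (max_localization_units locS).
have ker i r : p i r = 0 <-> ass (S i) r by have [[_ _]] := pP i.
exists K, p; split=> //; split=> //.
  move=> r r0; suff : left_loc_radical R r by rewrite rad0.
  by rewrite /left_loc_radical S_max => _ [i _ <-]; apply/ker.
(* For [j != i], some element of [ass (S j)] is a unit in [K i]: otherwise [p i] sends all of
   [ass (S j)] to nilpotents, making it nil modulo [ass (S i)]. On the diagonal 0 is a dummy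
   value. *)
have /choice [c cP] (ij : 'I_n * 'I_n) : exists c, ij.2 != ij.1 ->
    is_unit (p ij.1 c) /\ p ij.2 c = 0.
  case: ij => i j /=; have [ji|ji] := eqVneq j i; first by exists 0.
  have SjNi : S j <> S i by move/S_inj/eqP; rewrite (negPf ji).
  apply: contrapT => noc; apply: (nnil _ _ (Smax j) (Smax i) SjNi) => x y xj yi.
  have [[k xk]|xu] := nuK i (p i x); last first.
    by exfalso; apply: noc; exists x => _; split=> //; apply/ker.
  by exists k; apply/ker; rewrite rmorphXn rmorphD; have/ker -> := yi; rewrite addr0.
(* All factors are units in [K i], while the factor [c (i, j)] kills the product in [K j]. *)
exists (fun i => \prod_(j | j != i) c (i, j)); split=> [i|i j ji].
  rewrite rmorph_prod; apply: big_ind => [||j ji].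
  - exact: is_unit1.
  - exact: is_unitM.
  - by have [] := cP (i, j) ji.
rewrite rmorph_prod; apply: (@prod_eq0 _ _ _ _ _ j); rewrite ?mem_index_enum //.
by have [] := cP (i, j) ji.
Qed.

Lemma typeA_separating_family (n : nat) (S : 'I_n -> set R) :
  typeA R -> injective S -> max_Den R = [set S i | i in [set: 'I_n]] ->
  separating_family S.
Proof.
move=> hR S_inj S_max; case: hR.
- by move=> ?; exact: weakly_localizable_separating_family.
- move=> [_ [Q [phi [locC prodQ]]]].
  have [m [T [sepT]]] := product_localization_separating_family ass_regular_elements locC prodQ.
  by rewrite S_max => ST; exact: separating_family_reindex sepT S_inj (esym ST).
- move=> [S0 [[_ ass0 _] [Q [phi [locS prodQ]]]]].
  have [m [T [sepT]]] := product_localization_separating_family ass0 locS prodQ.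
  by rewrite S_max => ST; exact: separating_family_reindex sepT S_inj (esym ST).
Qed.

End TypeA.

Theorem theorem4p2 (R : nzRingType) (hR : typeA R)
    (n : nat) (S : 'I_n -> set R)
    (S_distinct : injective S)
    (S_max : max_Den R = [set S i | i in [set: 'I_n]]) :
  (n = 1%N ->
     forall i : 'I_n, core (S i) = S i /\ S i = ~` nil_radical R) /\
  ((2 <= n)%N ->
     forall i : 'I_n,
       core (S i) = S i `&` \bigcap_(j in [set j | j != i]) ass (S j) /\
       core (S i) !=set0).
Proof.
have [K [p [psep SE]]] := typeA_separating_family hR S_distinct S_max.
split=> [n1 i|_ i]; rewrite !SE.
  (* With one index the vanishing condition on the other factors in [separates_core] is vacuous. *)
  have I1 j : j = i by move: i j; rewrite n1 => i j; rewrite !ord1.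
  rewrite -(separates_nil_radical psep I1) (separates_core psep).
  by split=> //; apply/seteqP; split=> r /= => [[]//|?]; split=> // j; rewrite (I1 j) eqxx.
split; last exact: separates_core_neq0.
rewrite (separates_core psep); congr (_ `&` _); apply/seteqP; split=> r /= r0 j ji.
  by rewrite SE (separates_ass psep); exact: r0.
by have := r0 j ji; rewrite SE (separates_ass psep).
Qed.
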